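(* Let $\delta$ be a new atomic formula symbol (the fixed point operator of $A(p)=\neg(\exists x)x:p$). Then the logic $\mathsf{QLP}(\delta\leftrightarrow\neg(\exists x)x:\delta)_{\emptyset}$, i.e. $\mathsf{QLP}$ without the Axiom Necessitation rule, over the language extended by $\delta$, with the single additional axiom $\delta\leftrightarrow\neg(\exists x)x:\delta$, is inconsistent.
   Context: Fix countably many justification variables, propositional variables, and primitive function symbols of each arity $n\ge0$; a primitive term is $f(x_1,\dots,x_n)$ with $x_i$ variables. Terms of $\mathsf{QLP}$: $t::= x\mid f(x_1,\dots,x_n)\mid t\cdot t\mid t+t\mid !t\mid(t\forall x)$ ($x$ bound in $(t\forall x)$). Formulas: $A::= p\mid\bot\mid\neg A\mid A\wedge A\mid A\vee A\mid A\rightarrow A\mid t:A\mid(\forall x)A\mid(\exists x)A$, quantifiers over justification variables. Axioms: all propositional tautologies; Q1: $(\forall x)A(x)\rightarrow A(t)$, $t$ free for $x$; Q2: $(\forall x)(A\rightarrow B(x))\rightarrow(A\rightarrow(\forall x)B(x))$, $x$ not free in $A$; Q3: $A(t)\rightarrow(\exists x)A(x)$, $t$ free for $x$; Q4: $(\forall x)(A(x)\rightarrow B)\rightarrow((\exists x)A(x)\rightarrow B)$, $x$ not free in $B$; jK: $s:(A\rightarrow B)\rightarrow(t:A\rightarrow(s\cdot t):B)$; jT: $t:A\rightarrow A$; j4: $t:A\rightarrow !t:t:A$; Sum: $s:A\rightarrow(s+t):A$, $s:A\rightarrow(t+s):A$; UF: $(\exists y)y:(\forall x)t:A\rightarrow(t\forall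 x):(\forall x)A$, $y$ not free in $t$ or $A$. Rules: Modus Ponens; Gen: from $A$ infer $(\forall x)A$; qNec: from $A$ infer $(\exists x)x:A$, $x$ not free in $A$; Axiom Necessitation: from an axiom instance $A$ infer $f(x_1,\dots,x_n):A$. The subscript $\emptyset$ means Axiom Necessitation is dropped. All schemes and rules apply to formulas of the extended language. *)

(* Defs.v *)
From mathcomp Require Import all_boot.

Set Implicit Arguments.
Unset Strict Implicit.
Unset Printing Implicit Defensive.

Notation jvar := nat (only parsing).

(* [Prim f xs] with [xs : n.-tuple jvar] applies the [f]-th primitive function
   symbol of arity [n]; its arguments are variables, not arbitrary terms. *)
Inductive jterm : Type :=
| JVar of jvar
| Prim (n : nat) (f : nat) (xs : n.-tuple jvar)
| App of jterm & jterm
| Plus of jterm & jterm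
| Bang of jterm
| Unif (t : jterm) (x : jvar).

(* [E] is the type of additional atomic formula symbols: [form void] is the
   language of QLP, [form unit] its extension by one new symbol. *)
Inductive form (E : Type) : Type :=
| PVar of nat
| Ext of E
| Bot
| Neg of form E
| And of form E & form E
| Or of form E & form E
| Imp of form E & form E
| Just of jterm & form E
| All (x : jvar) (A : form E)
| Ex (x : jvar) (A : form E).

Arguments PVar {E}.
Arguments Bot {E}.

Definition Iff (E : Type) (A B : form E) : form E := And (Imp A B) (Imp B A).

Fixpoint free_tm (x : jvar) (t : jterm) : bool :=
  match t with
  | JVar y => x == y
  | Prim _ _ xs => x \in tval xs
  | App t1 t2 | Plus t1 t2 => free_tm x t1 || free_tm x t2
  | Bang t1 => free_tm x t1
  | Unif t1 y => (x != y) && free_tm x t1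
  end.

Fixpoint free (E : Type) (x : jvar) (A : form E) : bool :=
  match A with
  | PVar _ | Ext _ | Bot => false
  | Neg B => free x B
  | And B C | Or B C | Imp B C => free x B || free x C
  | Just t B => free_tm x t || free x B
  | All y B | Ex y B => (x != y) && free x B
  end.

(* [s] is free for [x]: no capture by [Unif], [All] or [Ex], and the result of
   the substitution is an expression of the language.  The latter fails exactly
   when a free occurrence of [x] as an argument of a primitive function symbol
   would have to be replaced by a term that is not a variable. *)
Fixpoint free_for_tm (s : jterm) (x : jvar) (t : jterm) : bool :=
  match t with
  | JVar _ => true
  | Prim _ _ xs => (x \in tval xs) ==> (if s is JVar _ then true else false)
  | App t1 t2 | Plus t1 t2 => free_for_tm s x t1 && free_for_tm s x t2
  | Bang t1 => free_for_tm s x t1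
  | Unif t1 y =>
      ~~ free_tm x (Unif t1 y) || ~~ free_tm y s && free_for_tm s x t1
  end.

Fixpoint free_for (E : Type) (s : jterm) (x : jvar) (A : form E) : bool :=
  match A with
  | PVar _ | Ext _ | Bot => true
  | Neg B => free_for s x B
  | And B C | Or B C | Imp B C => free_for s x B && free_for s x C
  | Just t B => free_for_tm s x t && free_for s x B
  | All y B | Ex y B =>
      ~~ free x (All y B) || ~~ free_tm y s && free_for s x B
  end.

(* Replaces the free occurrences of [x] by [s]; only meaningful when [s] is
   free for [x] (in particular the last branch of the [Prim] case is then
   reached only when [x] is not among [xs]). *)
Fixpoint subst_tm (x : jvar) (s : jterm) (t : jterm) : jterm :=
  match t with
  | JVar y => if y == x then s else JVar y
  | Prim n f xs =>
      if s is JVar z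
      then Prim f [tuple of [seq if y == x then z else y | y <- xs]]
      else Prim f xs
  | App t1 t2 => App (subst_tm x s t1) (subst_tm x s t2)
  | Plus t1 t2 => Plus (subst_tm x s t1) (subst_tm x s t2)
  | Bang t1 => Bang (subst_tm x s t1)
  | Unif t1 y => Unif (if y == x then t1 else subst_tm x s t1) y
  end.

Fixpoint subst (E : Type) (x : jvar) (s : jterm) (A : form E) : form E :=
  match A with
  | PVar p => PVar p
  | Ext e => Ext e
  | Bot => Bot
  | Neg B => Neg (subst x s B)
  | And B C => And (subst x s B) (subst x s C)
  | Or B C => Or (subst x s B) (subst x s C)
  | Imp B C => Imp (subst x s B) (subst x s C)
  | Just t B => Just (subst_tm x s t) (subst x s B)
  | All y B => All y (if y == x then B else subst x s B)
  | Ex y B => Ex y (if y == x then B else subst x s B)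
  end.

(* Atoms, [t : B] and quantified formulas are propositionally prime. *)
Fixpoint peval (E : Type) (v : form E -> bool) (A : form E) : bool :=
  match A with
  | Bot => false
  | Neg B => ~~ peval v B
  | And B C => peval v B && peval v C
  | Or B C => peval v B || peval v C
  | Imp B C => peval v B ==> peval v C
  | PVar _ | Ext _ | Just _ _ | All _ _ | Ex _ _ => v A
  end.

Definition tautology (E : Type) (A : form E) : Prop :=
  forall v : form E -> bool, peval v A.

(* Axiom instances of QLP together with the additional axioms [T]. *)
Inductive axiom (E : Type) (T : form E -> Prop) : form E -> Prop :=
| Ax_taut A : tautology A -> axiom T A
| Ax_Q1 x t A : free_for t x A -> axiom T (Imp (All x A) (subst x t A))
| Ax_Q2 x A B : ~~ free x A ->
    axiom T (Imp (All x (Imp A B)) (Imp A (All x B)))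
| Ax_Q3 x t A : free_for t x A -> axiom T (Imp (subst x t A) (Ex x A))
| Ax_Q4 x A B : ~~ free x B ->
    axiom T (Imp (All x (Imp A B)) (Imp (Ex x A) B))
| Ax_jK s t A B :
    axiom T (Imp (Just s (Imp A B)) (Imp (Just t A) (Just (App s t) B)))
| Ax_jT t A : axiom T (Imp (Just t A) A)
| Ax_j4 t A : axiom T (Imp (Just t A) (Just (Bang t) (Just t A)))
| Ax_SumL s t A : axiom T (Imp (Just s A) (Just (Plus s t) A))
| Ax_SumR s t A : axiom T (Imp (Just s A) (Just (Plus t s) A))
| Ax_UF x y t A : ~~ free_tm y t -> ~~ free y A ->
    axiom T (Imp (Ex y (Just (JVar y) (All x (Just t A))))
                 (Just (Unif t x) (All x A)))
| Ax_extra A : T A -> axiom T A.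

(* Theorems of QLP extended by [T]; Axiom Necessitation is available only when
   [an] is [true]. *)
Inductive QLP (E : Type) (an : bool) (T : form E -> Prop) : form E -> Prop :=
| QLP_ax A : axiom T A -> QLP an T A
| QLP_MP A B : QLP an T (Imp A B) -> QLP an T A -> QLP an T B
| QLP_Gen x A : QLP an T A -> QLP an T (All x A)
| QLP_qNec x A : ~~ free x A -> QLP an T A ->
    QLP an T (Ex x (Just (JVar x) A))
| QLP_AN n (f : nat) (xs : n.-tuple jvar) A : an -> axiom T A ->
    QLP an T (Just (Prim f xs) A).

Definition QLP_empty (E : Type) (T : form E -> Prop) : form E -> Prop :=
  QLP false T.

Definition inconsistent (E : Type) (L : form E -> Prop) : Prop := L Bot.

Definition delta : form unit := Ext tt.

Definition unprovable (x : jvar) (p : form unit) : form unit :=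
  Neg (Ex x (Just (JVar x) p)).

Definition fixpoint_axiom (x : jvar) : form unit :=
  Iff delta (unprovable x delta).

(* Main.v *)
Require Import Defs.
From mathcomp Require Import all_boot.

(** By jT and Q4, [(Ex x) x:delta] implies [delta], hence by the fixed point
    axiom its own negation; so it is refutable, which makes [delta] provable, and
    qNec then proves [(Ex x) x:delta]. *)

(** Propositional reasoning from two theorems, so that each such step reduces to a truth table. *)
Lemma QLP_taut2 {E : Type} {an : bool} {T : form E -> Prop} {A B C : form E} :
  tautology (Imp A (Imp B C)) -> QLP an T A -> QLP an T B -> QLP an T C.
Proof.
move=> taut thA thB; apply: QLP_MP thB; apply: QLP_MP thA.
exact/QLP_ax/Ax_taut.
Qed.

(** Generalizing jT for the term [x] gives the premise of Q4. *)
Lemma QLP_Ex_jT {E : Type} {an : bool} {T : form E -> Prop} {x} {A : form E} :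
  ~~ free x A -> QLP an T (Imp (Ex x (Just (JVar x) A)) A).
Proof.
move=> xA; apply: QLP_MP (QLP_ax _ (Ax_Q4 _ _ xA)) _.
exact/QLP_Gen/QLP_ax/Ax_jT.
Qed.

Theorem theorem23 (x : nat) :
  inconsistent (QLP_empty (fun A : form unit => A = fixpoint_axiom x)).
Proof.
rewrite /inconsistent /QLP_empty; set T := fun _ => _.
have fix_ax : QLP false T (fixpoint_axiom x) by exact/QLP_ax/Ax_extra.
have thD : QLP false T delta.
  (* If [delta] failed, the fixed point axiom would give [Ex x (Just (JVar x) delta)], which implies
     [delta]. *)
  apply: QLP_taut2 _ fix_ax (QLP_Ex_jT (isT : ~~ free x delta)) => v /=.
  by case: (v (Ext tt)); case: (v (Ex _ _)).
(* The side condition of qNec holds since the atom [delta] has no free variables. *)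
have thE : QLP false T (Ex x (Just (JVar x) delta)) by exact: QLP_qNec.
have thN : QLP false T (unprovable x delta).
  apply: QLP_taut2 _ fix_ax thD => v /=.
  by case: (v (Ext tt)); case: (v (Ex _ _)).
by apply: QLP_taut2 _ thN thE => v /=; case: (v _).
Qed.
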